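(* Let $u$ and $w$ be normalized weights. Assume that $u$ is convex and that either $u$ or $w$ is of moderate growth. Then the following are equivalent: (i) $u\preceq_{\mathfrak c}w$; (ii) $H^{\infty}_{\underline{\mathcal U}_{\mathfrak c}}\subseteq H^{\infty}_{\underline{\mathcal W}_{\mathfrak c}}$, with continuous inclusion; (iii) $H^{\infty}_{\overline{\mathcal U}_{\mathfrak c}}\subseteq H^{\infty}_{\overline{\mathcal W}_{\mathfrak c}}$, with continuous inclusion. If both weights are normalized and convex and at least one of them is of moderate growth, then the previous list of equivalences can be extended by: (iv) the associated sequences satisfy $\sup_{j\in\mathbb{N}_{>0}}(M^w_j/M^u_j)^{1/j}<+\infty$; (v) $v_{M^u}\preceq_{\mathfrak c}v_{M^w}$. Consequently, for normalized convex weights $u,w$ of moderate growth the relation $\sim_{\mathfrak c}$ characterizes the equivalence of the classes: $u\sim_{\mathfrak c}w$ if and only if $H^{\infty}_{\underline{\mathcal U}_{\mathfrak c}}=H^{\infty}_{\underline{\mathcal W}_{\mathfrak c}}$ as locally convex vector spaces, and if and only if $H^{\infty}_{\overline{\mathcal U}_{\mathfrak c}}=H^{\infty}_{\overline{\mathcal W}_{\mathfrak c}}$ as locally convex vector spaces.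
   Context: $\mathbb{N}=\{0,1,2,\dots\}$, $\mathbb{N}_{>0}=\{1,2,\dots\}$. A weight is a continuous, non-increasing function $v:[0,+\infty)\to(0,+\infty)$ with $\lim_{t\to+\infty}t^kv(t)=0$ for all $k\ge0$. It is normalized if $v(t)=1$ for all $t\in[0,1]$; convex if $t\mapsto-\log(v(e^t))$ is convex on $\mathbb{R}$; of moderate growth if there is $H\ge1$ with $v(Ht)\le e^Hv(t)^2$ for all $t\ge0$. $H(\mathbb{C})$ is the space of entire functions and $H^{\infty}_v:=\{f\in H(\mathbb{C}):\|f\|_v:=\sup_{z\in\mathbb{C}}|f(z)|v(|z|)<+\infty\}$, a Banach space with norm $\|\cdot\|_v$. For a weight $u$ and $c>0$ let $u_c(t):=u(ct)$, and put $\underline{\mathcal U}_{\mathfrak c}:=(u_c)_{c\in\mathbb{N}_{>0}}$, $\overline{\mathcal U}_{\mathfrak c}:=(u_{1/c})_{c\in\mathbb{N}_{>0}}$. $H^{\infty}_{\underline{\mathcal U}_{\mathfrak c}}:=\varinjlim_{c\to\infty}H^{\infty}_{u_c}$ is the locally convex inductive limit (an (LB)-space; as a set the union), and $H^{\infty}_{\overline{\mathcal U}_{\mathfrak c}}:=\varprojlim_{c\to\infty}H^{\infty}_{u_{1/c}}$ is the projective limit (a Fréchet space; as a set the intersection). Same notation with $w$, $\mathcal W$ in place of $u$, $\mathcal U$. For weights $v,w$: $v\preceq_{\mathfrak c}w$ means there are $c\ge1$ and $C\ge1$ with $w(ct)\le Cv(t)$ for all $t\ge0$; $v\sim_{\mathfrak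 c}w$ means $v\preceq_{\mathfrak c}w$ and $w\preceq_{\mathfrak c}v$. The sequence associated with a normalized weight $u$ is $M^u=(M^u_j)_{j\in\mathbb{N}}$, $M^u_j:=\sup_{t>0}t^ju(t)$. For a sequence $M$ of positive reals with $M_0=1$ and $(M_j)^{1/j}\to+\infty$, put $\omega_M(t):=\sup_{j\in\mathbb{N}}\log(t^j/M_j)$ for $t>0$, $\omega_M(0):=0$, and $v_M(t):=\exp(-\omega_M(t))$, which is a weight; $v_{M^u}$ is this weight for $M=M^u$. *)

(* Defs.v *)
From HB Require Import structures.
From mathcomp Require Import all_boot all_order all_algebra.
From mathcomp Require Import complex.
From mathcomp Require Import all_classical all_reals all_analysis.

Set Implicit Arguments.
Unset Strict Implicit.
Unset Printing Implicit Defensive.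

Import Order.TTheory GRing.Theory Num.Theory.
Import numFieldNormedType.Exports.

Local Open Scope classical_set_scope.
Local Open Scope ring_scope.
Local Open Scope complex_scope.

Section FinalTopology.
Variables (K : numFieldType) (I : Type) (F : I -> tvsType K) (E : lmodType K).

Definition abs_convex (V : set E) : Prop :=
  forall (a b : K) (x y : E), `|a| + `|b| <= 1 -> V x -> V y ->
    V (a *: x + b *: y).

Definition absorbing (V : set E) : Prop :=
  forall x, exists2 r : K, 0 < r & forall a : K, `|a| <= r -> V (a *: x).

Variable phi : forall i, {linear F i -> E}.

Definition final_base (V : set E) : Prop :=
  [/\ abs_convex V, absorbing V & forall i, nbhs (0 : F i) (phi i @^-1` V)].

(* E with the finest locally convex topology making every phi i continuous:
   a base of neighbourhoods of 0 is given by the absolutely convex absorbing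
   sets whose preimage by every phi i is a neighbourhood of 0. When E is the
   union of an increasing sequence of spaces F i and the phi i are the
   inclusions, this is their locally convex inductive limit. *)
Definition lc_final of (forall i, {linear F i -> E}) : Type := E.

Local Notation L := (lc_final phi).

HB.instance Definition _ := GRing.Lmodule.on L.

Definition final_open (U : set L) : Prop :=
  forall x, U x -> exists2 V, final_base V & forall y, V y -> U (x + y).

Lemma final_baseT : final_base setT.
Proof.
split=> // [x|i]; first by exists 1.
by rewrite preimage_setT; exact: filterT.
Qed.

Lemma final_baseI V W : final_base V -> final_base W -> final_base (V `&` W).
Proof.
move=> [V1 V2 V3] [W1 W2 W3]; split.
- by move=> a b x y ab [Vx Wx] [Vy Wy]; split; [exact: V1|exact: W1].
- move=> x; have [r r0 Vr] := V2 x; have [s s0 Ws] := W2 x.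
  have cmp : (r >=< s)%R by rewrite real_comparable// gtr0_real.
  exists (Num.min r s); first by rewrite comparable_lt_min ?r0.
  move=> a; rewrite comparable_le_min// => /andP[ar as_].
  by split; [exact: Vr|exact: Ws].
- by move=> i; rewrite preimage_setI; apply: filterI.
Qed.

Lemma final_baseZ (c : K) V : c != 0 -> final_base V ->
  final_base [set x | V (c *: x)].
Proof.
move=> c0 [V1 V2 V3]; split.
- move=> a b x y ab Vx Vy /=.
  rewrite scalerDr !scalerA ![c * _]mulrC -!scalerA; exact: V1.
- move=> x; have [r r0 Vr] := V2 x; exists (r / `|c|) => [|a].
    by rewrite divr_gt0 ?normr_gt0.
  rewrite ler_pdivlMr ?normr_gt0// => arc /=; rewrite scalerA; apply: Vr.
  by rewrite normrM mulrC.
- move=> i; have := @nbhs0Z _ _ _ c^-1 (_ : c^-1 != 0) (V3 i).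
  rewrite invr_eq0 => /(_ c0); apply: filterS => _ /= [x Vx <-].
  by rewrite linearZ/= scalerA mulfV// scale1r.
Qed.

Lemma final_openT : final_open setT.
Proof. by move=> x _; exists setT => //; exact: final_baseT. Qed.

Lemma final_openI : setI_closed final_open.
Proof.
move=> A B oA oB x [/oA[V bV VA] /oB[W bW WB]].
exists (V `&` W); first exact: final_baseI.
by move=> y [Vy Wy]; split; [exact: VA|exact: WB].
Qed.

Lemma final_open_bigU (J : Type) (f : J -> set L) :
  (forall j, final_open (f j)) -> final_open (\bigcup_j f j).
Proof.
move=> of_ x [j _ /of_[V bV Vf]]; exists V => // y Vy.
by exists j => //; exact: Vf.
Qed.

HB.instance Definition _ :=
  isOpenTopological.Build L final_openT final_openI final_open_bigU.

Lemma final_base0 V : final_base V -> V 0.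
Proof.
move=> [_ /(_ 0)[r r0 +] _] => /(_ 0).
by rewrite normr0 scale0r; apply; exact: ltW.
Qed.

Lemma final_base_half V x y : final_base V -> V (2 *: x) -> V (2 *: y) ->
  V (x + y).
Proof.
move=> [V1 _ _] Vx Vy; have := V1 2^-1 2^-1 _ _ _ Vx Vy.
rewrite !scalerA mulVf ?pnatr_eq0// !scale1r; apply.
by rewrite ger0_norm ?invr_ge0 ?ler0n// -div1r -splitr.
Qed.

Definition final_core (A : set L) : set L :=
  [set x | exists2 V, final_base V & forall y, V y -> A (x + y)].

Lemma final_core_open A : open (final_core A).
Proof.
move=> x [V bV VA].
have n2 : (2 : K) != 0 by rewrite pnatr_eq0.
exists [set x | V (2 *: x)]; first exact: final_baseZ.
move=> y /= Vy; exists [set x | V (2 *: x)]; first exact: final_baseZ.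
by move=> z /= Vz; rewrite -addrA; apply: VA; exact: final_base_half.
Qed.

Lemma final_core_sub A : final_core A `<=` A.
Proof. by move=> x [V bV /(_ 0)]; rewrite addr0; apply; exact: final_base0. Qed.

Lemma final_nbhsE (x : L) A : nbhs x A <-> final_core A x.
Proof.
split=> [|cA]; last first.
  rewrite nbhsE; exists (final_core A); last exact: final_core_sub.
  by split=> //; exact: final_core_open.
rewrite nbhsE => -[B [oB Bx] BA]; have [V bV VB] := oB _ Bx.
by exists V => // y /VB/BA.
Qed.

Lemma final_add_continuous : continuous (fun x : L * L => x.1 + x.2).
Proof.
move=> [x y] A /final_nbhsE[V bV VA] /=.
have n2 : (2 : K) != 0 by rewrite pnatr_eq0.
have bW := final_baseZ n2 bV.
exists ([set z | V (2 *: (z - x))], [set z | V (2 *: (z - y))]) => /=.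
  split; apply/final_nbhsE; exists [set x | V (2 *: x)] => // z /=;
    by rewrite [_ + z]addrC addrK.
move=> [z t] /= [Vz Vt].
have -> : z + t = (x + y) + ((z - x) + (t - y)).
  by rewrite addrACA ![_ + (_ - _)]addrC !subrK.
by apply: VA; exact: final_base_half.
Qed.

Lemma final_scale_continuous :
  continuous (fun z : K^o * L => z.1 *: z.2).
Proof.
move=> [a x] A /final_nbhsE[V bV VA] /=.
have n2 : (2 : K) != 0 by rewrite pnatr_eq0.
have [r r0 Vr] := let: And3 _ h _ := final_baseZ n2 bV in h x.
have [s [s0 as_]] : exists s : K, 0 < s /\ `|a| + r <= s.
  by exists (`|a| + r); rewrite ltr_wpDl.
have bW : final_base [set x | V ((2 * s) *: x)].
  by apply: final_baseZ => //; rewrite mulf_neq0// gt_eqF.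
exists (ball (a : K^o) r, [set z | V ((2 * s) *: (z - x))]) => /=.
  split; first exact: nbhsx_ballx.
  apply/final_nbhsE; exists [set x | V ((2 * s) *: x)] => // z /=.
  by rewrite [_ + z]addrC addrK.
move=> [b z] /= [ab Vz].
have -> : b *: z = a *: x + ((b - a) *: x + b *: (z - x)).
  by rewrite addrA -scalerDl [a + _]addrC subrK scalerBr [_ *: x + _]addrC subrK.
have {}ab : `|b - a| < r by move: ab; rewrite -ball_normE /= distrC.
apply: VA; apply: final_base_half => //; first by apply: Vr; exact: ltW.
have bs : `|b| <= s.
  rewrite (le_trans _ as_)// -[b](subrK a) (le_trans (ler_normD _ _))//.
  by rewrite addrC lerD2l ltW.
have := let: And3 h _ _ := bV in h (b / s) 0 _ 0 _ Vz (final_base0 bV).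
rewrite scaler0 addr0 scalerA [b / s]mulrC.
rewrite (_ : s^-1 * b * (2 * s) = 2 * b) ?scalerA; last first.
  by rewrite mulrAC mulrCA mulVf ?mulr1// gt_eqF.
apply; rewrite normr0 addr0 normrM normfV (gtr0_norm s0) mulrC.
by rewrite ler_pdivrMr// mul1r.
Qed.

Lemma final_locally_convex :
  exists2 B : set_system L, (forall b, b \in B -> convex_set b) & basis B.
Proof.
exists [set U | open U /\ convex_set U] => [b /set_mem[]//|].
split=> [U []//|x A] /final_nbhsE[V bV VA].
exists (final_core [set z | V (z - x)]) => [|y /final_core_sub/= Vy]; last first.
  by rewrite -[y](subrK x) addrC; exact: VA.
split; last by exists V => // y; rewrite /= [x + y]addrC addrK.
split; first exact: final_core_open.
move=> y z l /set_mem[W bW Wy] /set_mem[W' bW' Wz]; apply/mem_set.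
exists (W `&` W'); first exact: final_baseI.
move=> t [Wt Wt'] /=.
have {Wt}Vy := Wy _ Wt; have {Wt'}Vz := Wz _ Wt'.
have l0 : 0 <= l%:num by [].
have l1 : 0 <= 1 - l%:num by rewrite subr_ge0.
have ll : l%:num + (1 - l%:num) = 1 by rewrite addrC subrK.
have := let: And3 h _ _ := bV in h l%:num (1 - l%:num) _ _ _ Vy Vz.
rewrite (ger0_norm l0) (ger0_norm l1) ll => /(_ (lexx _)).
rewrite /= [X in V (X + _ - _)](_ : _ = l%:num *: y + (1 - l%:num) *: z)//.
congr (V _); rewrite -[RHS]addrA -[y + t - x]addrA -[z + t - x]addrA.
move: (t - x) => w; rewrite !scalerDr.
by rewrite addrACA -[X in _ + X]scalerDl ll scale1r.
Qed.

HB.instance Definition _ :=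
  PreTopologicalNmodule_isTopologicalNmodule.Build L final_add_continuous.
HB.instance Definition _ :=
  TopologicalNmodule_isTopologicalLmodule.Build K L final_scale_continuous.
HB.instance Definition _ := PreTopologicalLmod_isTvs.Build K L
  final_add_continuous final_scale_continuous final_locally_convex.
HB.instance Definition _ := Uniform_isTvs.Build K L final_locally_convex.

Lemma lc_final_continuous i : continuous (phi i : F i -> L).
Proof.
move=> x A /final_nbhsE[V [_ _ bV] VA].
rewrite /nbhs/=; have /= := nbhsT x (bV i); apply: filterS => _ [y Vy <-].
by rewrite /= linearD; exact: VA.
Qed.

End FinalTopology.

Section Weights.
Variable R : realType.

(* Weights live on [0, +oo[; the values of v at negative reals play no role. *)
Record is_weight (v : R -> R) : Prop := IsWeight {
  weight_continuous : {within `[0, +oo[, continuous v};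
  weight_nonincreasing : {in `[0, +oo[ &, {homo v : s t / s <= t >-> t <= s}};
  weight_gt0 : forall t, 0 <= t -> 0 < v t;
  weight_cvg0 : forall k : nat, t ^+ k * v t @[t --> +oo] --> 0 }.

Record weight := Weight { wfun :> R -> R; weightP : is_weight wfun }.

Lemma dilate_is_weight (c : {posnum R}) (v : weight) :
  is_weight (fun t => v (c%:num * t)).
Proof.
have [vc vd v0 vk] := weightP v.
have c0 : 0 < c%:num by [].
split.
- move/continuous_within_itvcyP: vc => [vc vc0].
  apply/continuous_within_itvcyP; split.
    move=> t; rewrite in_itv/= andbT => t0.
    apply: (@continuous_comp _ _ _ ( *%R c%:num) v); first exact: mulrl_continuous.
    by apply: vc; rewrite in_itv/= andbT mulr_gt0.
  rewrite mulr0; apply/cvgrPdist_lt => e e0.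
  move/cvgrPdist_lt : vc0 => /(_ e e0)[d/= d0 dv].
  exists (d / c%:num) => /=; first by rewrite divr_gt0.
  move=> t /=; rewrite sub0r normrN => td t0; apply: dv; last by rewrite mulr_gt0.
  by rewrite /= sub0r normrN normrM gtr0_norm// mulrC -ltr_pdivlMr.
- move=> s t; rewrite !in_itv/= !andbT => s0 t0 st.
  by apply: vd; rewrite ?in_itv/= ?andbT ?mulr_ge0// ler_pM2l.
- by move=> t t0; apply: v0; rewrite mulr_ge0.
- move=> k; have /cvgrPdist_lt vk' := vk k; apply/cvgrPdist_lt => e e0.
  have ek : 0 < e * c%:num ^+ k by rewrite mulr_gt0// exprn_gt0.
  have [M [Mr Mv]] := vk' _ ek.
  exists (M / c%:num); split; first exact: num_real.
  move=> t Mt; have := Mv (c%:num * t).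
  rewrite mulrC -ltr_pdivrMr// => /(_ Mt).
  rewrite !sub0r !normrN exprMn mulrAC normrM (gtr0_norm (exprn_gt0 k c0)).
  by rewrite ltr_pM2r ?exprn_gt0 ?[v _]mulrC.
Qed.

Definition dilate (c : {posnum R}) (v : weight) : weight :=
  Weight (dilate_is_weight c v).

Definition normalized (v : R -> R) : Prop := forall t, 0 <= t <= 1 -> v t = 1.

(* convexity of t |-> - log (v (e^t)) on the whole real line *)
Definition convex_weight (v : R -> R) : Prop :=
  convex_function [set: R^o] (fun t : R^o => - ln (v (expR t)) : R^o).

Definition moderate_growth (v : R -> R) : Prop :=
  exists2 H : R, 1 <= H &
    forall t, 0 <= t -> v (H * t) <= expR H * v t ^+ 2.

Definition preceq_c (v w : R -> R) : Prop :=
  exists c C : R, [/\ 1 <= c, 1 <= C &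
    forall t, 0 <= t -> w (c * t) <= C * v t].

Definition sim_c (v w : R -> R) : Prop := preceq_c v w /\ preceq_c w v.

(* The supremum is finite for every weight, by the decay condition. *)
Definition assoc_seq (u : R -> R) (j : nat) : R :=
  sup [set t ^+ j * u t | t in `]0, +oo[].

(* For sequences M of positive reals with M_0 = 1 and M_j^(1/j) --> +oo the
   set is bounded above, so that sup is the true supremum. *)
Definition omega_seq (M : nat -> R) (t : R) : R :=
  if 0 < t then sup (range (fun j => ln (t ^+ j / M j))) else 0.

Definition weight_seq (M : nat -> R) (t : R) : R := expR (- omega_seq M t).

End Weights.

Section HinfSpaces.
Variable R : realType.
Local Notation C := (R[i]^o).
Local Notation normc := (@Normc.normc R).
Implicit Types (u v w : weight R) (f g : C -> C).

Definition entire f : Prop := forall z : C, derivable f z 1.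

Definition weighted v f : set R :=
  range (fun z : C => normc (f z) * v (normc z)).

Definition Hinf_set v : {pred C -> C} :=
  fun f => `[< entire f /\ has_ubound (weighted v f) >].

Lemma normc_ge0 (z : R[i]) : 0 <= normc z.
Proof. by case: z => a b /=; rewrite sqrtr_ge0. Qed.

Lemma normcZ (a : R[i]) f z : normc ((a *: f) z) = normc a * normc (f z).
Proof. exact: Normc.normcM. Qed.

Lemma weight_normc_gt0 v (z : R[i]) : 0 < v (normc z).
Proof. by apply: weight_gt0; [exact: weightP|exact: normc_ge0]. Qed.

Lemma weighted_le v f z b : ubound (weighted v f) b ->
  normc (f z) * v (normc z) <= b.
Proof. by apply; exists z. Qed.

Lemma Hinf_set_submod v : submod_closed (Hinf_set v).
Proof.
split.
  apply/asboolP; split; first by move=> z; exact: derivable_cst.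
  by exists 0 => _ [z _ <-]; rewrite Normc.normc0 mul0r.
move=> a f g /asboolP[ef [bf fb]] /asboolP[eg [bg gb]]; apply/asboolP; split.
  by move=> z; apply: derivableD => //; exact: derivableZ.
exists (normc a * bf + bg) => _ [z _ <-].
have vz := ltW (weight_normc_gt0 v z).
rewrite (le_trans (ler_wpM2r vz (le_normcD _ _)))// mulrDl.
rewrite lerD ?(weighted_le _ gb)//.
by rewrite normcZ -mulrA ler_wpM2l ?normc_ge0 ?weighted_le.
Qed.

HB.instance Definition _ v :=
  GRing.isSubmodClosed.Build R[i] (C -> C) (Hinf_set v) (Hinf_set_submod v).

Definition Hinf v := {f : C -> C | f \in Hinf_set v}.

HB.instance Definition _ v := SubChoice.on (Hinf v).
HB.instance Definition _ v := [SubChoice_isSubLmodule of Hinf v by <:].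

Lemma Hinf_bounded v (f : Hinf v) : has_ubound (weighted v (val f)).
Proof. by have /asboolP[] := valP f. Qed.

Lemma weighted_has_sup v (f : Hinf v) : has_sup (weighted v (val f)).
Proof. by split; [exists (normc (val f 0) * v (normc 0)), 0|exact: Hinf_bounded]. Qed.

(* Norms of a complex normed space take values in R[i] in this library, hence
   the embedding of the real supremum. *)
Definition Hinf_norm v (f : Hinf v) : R[i] := (sup (weighted v (val f)))%:C.

Lemma weighted_le_sup v (f : Hinf v) z :
  normc (val f z) * v (normc z) <= sup (weighted v (val f)).
Proof. by apply: sup_ubound; [exact: Hinf_bounded|exists z]. Qed.

Lemma Hinf_normD v (f g : Hinf v) : Hinf_norm (f + g) <= Hinf_norm f + Hinf_norm g.
Proof.
rewrite /Hinf_norm -rmorphD lecR; apply: ge_sup.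
  by have [] := weighted_has_sup (f + g).
move=> _ [z _ <-]; have vz := ltW (weight_normc_gt0 v z).
rewrite (le_trans (ler_wpM2r vz (le_normcD _ _)))// mulrDl.
by rewrite lerD ?weighted_le_sup.
Qed.

Lemma Hinf_normZ_le v (a : R[i]) (f : Hinf v) :
  Hinf_norm (a *: f) <= `|a| * Hinf_norm f.
Proof.
have -> : `|a| = (normc a)%:C by [].
rewrite /Hinf_norm -rmorphM lecR; apply: ge_sup.
  by have [] := weighted_has_sup (a *: f).
move=> _ [z _ <-].
by rewrite normcZ -mulrA ler_wpM2l ?normc_ge0 ?weighted_le_sup.
Qed.

Lemma Hinf_normZ v (a : R[i]) (f : Hinf v) :
  Hinf_norm (a *: f) = `|a| * Hinf_norm f.
Proof.
have [->|a0] := eqVneq a 0.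
  have E z : normc (val (0 : Hinf v) z) * v (normc z) = 0.
    by rewrite [X in X * _]Normc.normc0 mul0r.
  have W : weighted v (val (0 : Hinf v)) = [set 0].
    apply/seteqP; split=> [_ [z _ <-]|_ ->] /=; first exact: E.
    by exists 0 => //; exact: E.
  by rewrite scale0r normr0 mul0r /Hinf_norm W sup1.
apply/eqP; rewrite eq_le Hinf_normZ_le/=.
rewrite -ler_pdivlMl ?normr_gt0// -normfV.
by rewrite -{1}[f](scalerK a0) Hinf_normZ_le.
Qed.

Lemma Hinf_norm_eq0 v (f : Hinf v) : Hinf_norm f = 0 -> f = 0.
Proof.
case=> f0; apply/val_inj/funext => z; apply: Normc.eq0_normc.
apply/eqP; rewrite eq_le normc_ge0 andbT -(pmulr_lle0 _ (weight_normc_gt0 v z)).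
by rewrite -f0; exact: weighted_le_sup.
Qed.

HB.instance Definition _ v := @Lmodule_isNormed.Build R[i] (Hinf v)
  (@Hinf_norm v) (@Hinf_normD v) (@Hinf_normZ v) (@Hinf_norm_eq0 v).

(* The families (u_c) and (u_{1/c}), c >= 1, are indexed by n with c = n + 1. *)
Definition sys_lower u (n : nat) : weight R := dilate n.+1%:R%:pos u.

Definition sys_upper u (n : nat) : weight R := dilate (n.+1%:R^-1)%:pos u.

Definition Hlower_set u : {pred C -> C} :=
  fun f => `[< exists n, f \in Hinf_set (sys_lower u n) >].

Lemma Hinf_set_le v w : (forall t, 0 <= t -> w t <= v t) ->
  {subset Hinf_set v <= Hinf_set w}.
Proof.
move=> wv f /asboolP[ef [b fb]]; apply/asboolP; split=> //.
exists b => _ [z _ <-]; apply: le_trans (weighted_le z fb).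
by rewrite ler_wpM2l ?normc_ge0// wv ?normc_ge0.
Qed.

Lemma sys_lower_le u m n : (m <= n)%N ->
  forall t, 0 <= t -> sys_lower u n t <= sys_lower u m t.
Proof.
move=> mn t t0; apply: (weight_nonincreasing (weightP u)).
- by rewrite in_itv/= andbT mulr_ge0.
- by rewrite in_itv/= andbT mulr_ge0.
- by rewrite ler_wpM2r// ler_nat.
Qed.

Lemma Hlower_set_submod u : submod_closed (Hlower_set u).
Proof.
split; first by apply/asboolP; exists 0; exact: rpred0.
move=> a f g /asboolP[m fm] /asboolP[n gn]; apply/asboolP.
exists (maxn m n); apply: rpredD; first apply: rpredZ.
  by apply: Hinf_set_le fm; apply: sys_lower_le; exact: leq_maxl.
by apply: Hinf_set_le gn; apply: sys_lower_le; exact: leq_maxr.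
Qed.

HB.instance Definition _ u :=
  GRing.isSubmodClosed.Build R[i] (C -> C) (Hlower_set u) (Hlower_set_submod u).

Definition Hlower_space u := {f : C -> C | f \in Hlower_set u}.

HB.instance Definition _ u := SubChoice.on (Hlower_space u).
HB.instance Definition _ u := [SubChoice_isSubLmodule of Hlower_space u by <:].

Lemma Hinf_lower_subproof u n (f : Hinf (sys_lower u n)) :
  val f \in Hlower_set u.
Proof. by apply/asboolP; exists n; exact: valP. Qed.

Definition Hinf_lower u n (f : Hinf (sys_lower u n)) : Hlower_space u :=
  exist _ (val f) (Hinf_lower_subproof f).

Lemma Hinf_lower_linear u n : linear (@Hinf_lower u n).
Proof. by move=> a f g; exact: val_inj. Qed.

HB.instance Definition _ u n := GRing.isLinear.Build R[i] _ _ _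
  (@Hinf_lower u n) (@Hinf_lower_linear u n).

(* locally convex inductive limit of the Banach spaces Hinf (u_c) *)
Definition Hlower u := lc_final (fun n => @Hinf_lower u n : {linear _ -> _}).

HB.instance Definition _ u := Tvs.on (Hlower u).

Definition Hlower_fun u (f : Hlower u) : C -> C := val (f : Hlower_space u).

Definition Hupper_set u : {pred C -> C} :=
  fun f => `[< forall n, f \in Hinf_set (sys_upper u n) >].

Lemma Hupper_set_submod u : submod_closed (Hupper_set u).
Proof.
split; first by apply/asboolP => n; exact: rpred0.
move=> a f g /asboolP fn /asboolP gn; apply/asboolP => n.
by apply: rpredD (gn n); apply: rpredZ; exact: fn n.
Qed.

HB.instance Definition _ u :=
  GRing.isSubmodClosed.Build R[i] (C -> C) (Hupper_set u) (Hupper_set_submod u).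

Definition Hupper_space u := {f : C -> C | f \in Hupper_set u}.

HB.instance Definition _ u := SubChoice.on (Hupper_space u).
HB.instance Definition _ u := [SubChoice_isSubLmodule of Hupper_space u by <:].

Lemma Hinf_upper_subproof u n (f : Hupper_space u) :
  val f \in Hinf_set (sys_upper u n).
Proof. by have /asboolP := valP f. Qed.

Definition Hinf_upper u (f : Hupper_space u) :
    prod_topology (fun n => Hinf (sys_upper u n)) :=
  fun n => exist _ (val f) (Hinf_upper_subproof n f).

(* projective limit of the Banach spaces Hinf (u_{1/c}): the intersection, with
   the topology induced by its embedding in the product *)
Definition Hupper u := initial_topology (@Hinf_upper u).

HB.instance Definition _ u := Uniform.on (Hupper u).
HB.instance Definition _ u := GRing.Lmodule.copy (Hupper u) (Hupper_space u).

Definition Hupper_fun u (f : Hupper u) : C -> C := val (f : Hupper_space u).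

End HinfSpaces.

(* Spaces of functions E and F are compared through their embeddings i and j in
   a common set T: there is a continuous map E -> F that is the identity on the
   underlying functions. *)
Definition cts_included (T : Type) (E F : topologicalType)
    (i : E -> T) (j : F -> T) : Prop :=
  exists2 k : E -> F, (forall x, j (k x) = i x) & continuous k.

(* same underlying subset of T and same open sets; the vector space operations
   of the spaces compared here are always the pointwise ones *)
Definition same_space (T : Type) (E F : topologicalType)
    (i : E -> T) (j : F -> T) : Prop :=
  range i = range j /\
  [set i @` U | U in open] = [set j @` V | V in open].

(* Main.v *)
Require Import Defs.
From HB Require Import structures.
From mathcomp Require Import all_boot all_order all_algebra.
From mathcomp Require Import complex ring lra.
From mathcomp Require Import all_classical all_reals all_analysis.

Set Implicit Arguments.
Unset Strict Implicit.
Unset Printing Implicit Defensive.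

Import Order.TTheory GRing.Theory Num.Theory.
Import numFieldNormedType.Exports.

Local Open Scope classical_set_scope.
Local Open Scope ring_scope.

(** The weights are compared through their associated sequences. Write M for
    the sequence of u and N for that of w. The pivot of the proof is the
    condition [geom_dominated M N]: N_j <= A^(j+1) M_j for some A >= 1. For
    normalized weights it is a rewording of the bound on the roots
    (N_j / M_j)^(1/j) ([geom_dominated_rootP]).

    From [preceq_c u w] to function spaces: if w(c t) <= C u(t), every dilate of u
    dominates some dilate of w, and every dilate of w is dominated by some
    dilate of u. Each domination gives a bounded inclusion of Banach spaces,
    and the universal properties of the inductive and the projective limit
    turn these step-wise inclusions into continuous ones
    ([preceq_c_Hlower], [preceq_c_Hupper]).

    From function spaces to [geom_dominated]: for the inductive limit, test
    the inclusion on the single function f(z) = sum_k z^k / (2^k M_k). Since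
    t^k u(t) <= M_k, it satisfies |f(z)| u(|z|) <= 2; since its coefficients
    are positive, f(t) dominates each of its terms on the positive axis, so an
    estimate of f by some dilate of w bounds N_j by a geometric factor times
    M_j ([Hlower_geom_dominated]). For the projective limit, the norm of z^j
    in the space of the dilated weight u(./c) is c^j M_j; were domination to
    fail, suitable multiples of monomials would tend to 0 in the space of u
    while keeping norm at least 1 in that of w ([Hupper_geom_dominated]).

    From [geom_dominated M N] back to [preceq_c u w], through the weights v_M and
    v_N of the two sequences: as v_M(t) = inf_j M_j / t^j, domination of the
    sequences gives v_N(c t) <= C v_M(t) ([geom_dominated_weight_seq]). Always
    w <= v_N, and convexity of u gives v_M(t) <= t u(t) for t > 1
    ([convex_weight_seq_le]), hence w(c t) <= C t u(t). Moderate growth of either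
    weight absorbs the factor t: it trades a dilation for an extra factor u(t)
    or w(t), and t u(t), t w(t) are bounded ([preceq_c_of_weight_seq]).

    Finally, two spaces of functions coincide as topological spaces exactly
    when each is continuously included in the other ([same_spaceP]), which
    gives the characterization of the equivalence of weights. *)

(** * Subgradients of convex functions on the line *)

Section ConvexFunctions.
Variable R : realType.
Implicit Types phi : R -> R.

Lemma convex_three_points phi a x b :
  convex_function [set: R^o] (phi : R^o -> R^o) -> a < x -> x < b ->
  (b - a) * phi x <= (b - x) * phi a + (x - a) * phi b.
Proof.
move=> cphi ax xb; have ba : 0 < b - a by rewrite subr_gt0 (lt_trans ax).
have t0 : 0 <= (b - x) / (b - a) by rewrite divr_ge0 ?ltW// subr_gt0.
have t1 : (b - x) / (b - a) <= 1 by rewrite ler_pdivrMr//; lra.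
set l := (b - x) / (b - a) in t0 t1.
have : phi (l * a + (1 - l) * b) <= l * phi a + (1 - l) * phi b :=
  cphi (Itv01 t0 t1) a b (mem_set I) (mem_set I).
have lba : l * (b - a) = b - x by rewrite mulfVK// gt_eqF.
rewrite (_ : l * a + (1 - l) * b = x); last by lra.
move/(ler_wpM2l (ltW ba))/le_trans; apply.
have -> : x - a = (1 - l) * (b - a) by lra.
by rewrite -lba le_eqVlt; apply/orP; left; apply/eqP; ring.
Qed.

(** The supremum of the slopes of the chords arriving at [x] from the left is a
    subgradient: it is at most every slope leaving [x] to the right. *)
Lemma convex_subgradient phi x :
  convex_function [set: R^o] (phi : R^o -> R^o) ->
  exists s, forall y, phi x + s * (y - x) <= phi y.
Proof.
move=> cphi; pose slope a := (phi x - phi a) / (x - a).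
have slope_le a b : a < x -> x < b -> slope a <= (phi b - phi x) / (b - x).
  move=> ax xb; have := convex_three_points cphi ax xb.
  rewrite ler_pdivrMr ?subr_gt0// mulrAC ler_pdivlMr ?subr_gt0//; nra.
pose S := [set slope a | a in [set a | a < x]].
have S0 : S !=set0 by exists (slope (x - 1)), (x - 1) => //=; lra.
have Sub b : x < b -> ubound S ((phi b - phi x) / (b - x)).
  by move=> xb _ [a /= ax <-]; exact: slope_le.
have xx1 : x < x + 1 by lra.
exists (sup S) => y; have [yx|xy|->] := ltgtP y x; last by rewrite subrr; lra.
- have : slope y <= sup S.
    apply: ub_le_sup; last by exists y.
    by exists ((phi (x + 1) - phi x) / (x + 1 - x)); exact: Sub.
  by rewrite ler_pdivrMr ?subr_gt0//; nra.
- have : sup S <= (phi y - phi x) / (y - x) by apply: ge_sup => //; exact: Sub.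
  by rewrite ler_pdivlMr ?subr_gt0//; nra.
Qed.

End ConvexFunctions.

(** * Associated sequences and their weights *)

Section AssociatedSequence.
Variable R : realType.
Implicit Types (v : weight R) (M : nat -> R) (t b : R) (j : nat).

Lemma weight_le v s t : 0 <= s -> s <= t -> v t <= v s.
Proof.
move=> s0 st; apply: (weight_nonincreasing (weightP v)) => //;
  by rewrite in_itv/= andbT// (le_trans s0).
Qed.

Lemma weightp_gt0 v t : 0 <= t -> 0 < v t.
Proof. exact: (weight_gt0 (weightP v)). Qed.

Lemma moments_has_ubound v j :
  has_ubound [set t ^+ j * v t | t in `]0, +oo[].
Proof.
have /cvgrPdist_lt /(_ 1 ltr01) [T [_ vT]] := weight_cvg0 (weightP v) j.
exists (Num.max 1 (`|T| ^+ j * v 0)) => _ [t /= + <-].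
rewrite in_itv/= andbT => t0.
rewrite le_max; have [tT|Tt] := leP t T; last first.
  apply/orP; left; apply/ltW; apply: le_lt_trans (vT _ Tt).
  by rewrite sub0r normrN ler_norm.
apply/orP; right; apply: ler_pM.
- by rewrite exprn_ge0// ltW.
- by rewrite ltW// weightp_gt0// ltW.
- by rewrite lerXn2r ?nnegrE ?normr_ge0 ?(ltW t0)// (le_trans tT) ?ler_norm.
- by rewrite weight_le// ltW.
Qed.

Lemma assoc_seq_ge v j t : 0 < t -> t ^+ j * v t <= assoc_seq v j.
Proof.
move=> t0; apply: ub_le_sup; first exact: moments_has_ubound.
by exists t => //=; rewrite in_itv/= andbT.
Qed.

Lemma assoc_seq_le v j b : (forall t, 0 < t -> t ^+ j * v t <= b) ->
  assoc_seq v j <= b.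
Proof.
move=> vb; apply: ge_sup => [|_ [t /= + <-]]; last first.
  by rewrite in_itv/= andbT; exact: vb.
by exists (1 ^+ j * v 1), 1 => //=; rewrite in_itv/= andbT ltr01.
Qed.

Lemma assoc_seq_gt0 v j : 0 < assoc_seq v j.
Proof.
apply: lt_le_trans (assoc_seq_ge v j (@ltr01 R)).
by rewrite expr1n mul1r weightp_gt0.
Qed.

Lemma assoc_seq0 v : normalized v -> assoc_seq v 0 = 1.
Proof.
move=> nv; have v1 t : 0 <= t <= 1 -> v t = 1 by exact: nv.
apply/eqP; rewrite eq_le; apply/andP; split.
  apply: assoc_seq_le => t t0; rewrite expr0 mul1r.
  by rewrite -(v1 0) ?lexx ?ler01// weight_le// ltW.
have := assoc_seq_ge v 0 (@ltr01 R).
by rewrite expr0 mul1r v1// ler01 lexx.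
Qed.

Lemma assoc_seq_ge0 v j t : normalized v -> 0 <= t ->
  t ^+ j * v t <= assoc_seq v j.
Proof.
move=> nv; rewrite le_eqVlt => /predU1P[<-|]; last exact: assoc_seq_ge.
case: j => [|j]; last by rewrite expr0n mul0r ltW// assoc_seq_gt0.
by rewrite assoc_seq0// expr0 mul1r; rewrite (nv 0)// lexx ler01.
Qed.

Lemma weight_seq_gt0 M t : 0 < weight_seq M t.
Proof. exact: expR_gt0. Qed.

Lemma weight_seq0 M : weight_seq M 0 = 1.
Proof. by rewrite /weight_seq /omega_seq ltxx oppr0 expR0. Qed.

(** This lemma and the next say that [weight_seq M t] is the infimum of
    [M j / t ^+ j]. The lower bound [b] in [weight_seq_le] makes the set of
    logarithms bounded above, without which the supremum in [omega_seq] would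
    be a default value. *)
Lemma weight_seq_ge M t b : (forall j, 0 < M j) -> 0 < t -> 0 < b ->
  (forall j, t ^+ j * b <= M j) -> b <= weight_seq M t.
Proof.
move=> M0 t0 b0 bM; rewrite /weight_seq /omega_seq t0.
rewrite -[leLHS]lnK ?posrE// ler_expR lerNr.
apply: ge_sup => [|_ [j _ <-]]; first by exists (ln (t ^+ 0 / M 0)), 0%N.
rewrite -lnV ?posrE// ler_ln ?posrE ?invr_gt0 ?divr_gt0 ?exprn_gt0//.
by rewrite ler_pdivrMr// -ler_pdivrMl ?invr_gt0// invrK mulrC.
Qed.

Lemma weight_seq_le M t b j : (forall j, 0 < M j) -> 0 < t -> 0 < b ->
  (forall j, t ^+ j * b <= M j) -> t ^+ j * weight_seq M t <= M j.
Proof.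
move=> M0 t0 b0 bM; rewrite /weight_seq /omega_seq t0.
rewrite expRN ler_pdivrMr ?expR_gt0// mulrC -ler_pdivrMr//.
rewrite -[leLHS]lnK ?posrE ?divr_gt0 ?exprn_gt0// ler_expR.
apply: ub_le_sup; last by exists j.
exists (ln b^-1) => _ [i _ <-].
rewrite ler_ln ?posrE ?invr_gt0 ?divr_gt0 ?exprn_gt0//.
by rewrite ler_pdivrMr// -ler_pdivrMl ?invr_gt0// invrK mulrC.
Qed.

Lemma weight_seq_assoc_ge v t b : 0 < t -> 0 < b ->
  (forall j, t ^+ j * b <= assoc_seq v j) -> b <= weight_seq (assoc_seq v) t.
Proof. by move=> t0 b0; apply: weight_seq_ge => // j; exact: assoc_seq_gt0. Qed.

Lemma weight_seq_assoc_le v t j : 0 < t ->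
  t ^+ j * weight_seq (assoc_seq v) t <= assoc_seq v j.
Proof.
move=> t0; apply: (@weight_seq_le _ _ (v t)) => //.
- by move=> i; exact: assoc_seq_gt0.
- by rewrite weightp_gt0// ltW.
- by move=> i; exact: assoc_seq_ge.
Qed.

Lemma weight_le_weight_seq v t : 0 < t -> v t <= weight_seq (assoc_seq v) t.
Proof.
move=> t0; apply: weight_seq_assoc_ge => // [|j]; last exact: assoc_seq_ge.
by rewrite weightp_gt0// ltW.
Qed.

(** With [phi x = - ln (v (expR x))], let [s] be a subgradient of [phi] at
    [ln t] and [j] its integer part. The affine minorant of [phi] bounds
    [ln (M j)] by [j.+1 * ln t - phi (ln t)], that is
    [M j <= t ^+ j.+1 * v t]; the rounding of [s] costs the factor [t]. *)
Lemma convex_weight_seq_le v t : normalized v -> convex_weight v -> 1 < t ->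
  weight_seq (assoc_seq v) t <= t * v t.
Proof.
move=> nv cv t1; have t0 : 0 < t by rewrite (lt_trans ltr01).
have [s sub] := convex_subgradient (ln t) cv.
have v1 x : 0 <= x <= 1 -> v x = 1 by exact: nv.
have lnt : 0 < ln t by rewrite ln_gt0.
have vt0 : 0 < v t by rewrite weightp_gt0// ltW.
have vt1 : v t <= 1 by rewrite -(v1 0) ?lexx ?ler01// weight_le// ltW.
rewrite lnK ?posrE// in sub.
have sub0 : - ln (v t) - s * ln t <= 0.
  have := sub 0; rewrite expR0 (v1 1) ?ler01 ?lexx// ln1; lra.
have s0 : 0 <= s.
  have lv : ln (v t) <= 0 by rewrite ln_le0.
  by rewrite -(pmulr_lge0 _ lnt); lra.
have Hs := truncn_itv s0; set j := Num.truncn s in Hs.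
(* For x <= 1 the left side is at most 1, and the subgradient inequality at
   0 = ln 1 says that 1 is at most the right side. *)
have key x : 0 < x -> x ^+ j * v x <= t ^+ j * (t * v t).
  move=> x0; have vx0 : 0 < v x by rewrite weightp_gt0// ltW.
  rewrite mulrA -exprSr.
  rewrite -ler_ln ?posrE ?mulr_gt0 ?exprn_gt0//.
  rewrite !lnM ?posrE ?exprn_gt0// !lnXn//.
  have jt : s * ln t <= ln t *+ j.+1.
    by rewrite -mulr_natr mulrC ler_pM2l// ltW; case/andP: Hs.
  have [x1|/ltW x1] := leP x 1.
    have : ln x *+ j <= 0 by rewrite mulrn_wle0// ln_le0.
    have -> : v x = 1 by apply: v1; rewrite (ltW x0) x1.
    by rewrite ln1; lra.
  have := sub (ln x); rewrite lnK ?posrE//.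
  have : ln x *+ j <= s * ln x.
    by rewrite -mulr_natr mulrC ler_wpM2r ?ln_ge0//; case/andP: Hs.
  by lra.
have := weight_seq_assoc_le v j t0.
move=> /le_trans/(_ (assoc_seq_le key)).
by rewrite ler_pM2l// exprn_gt0.
Qed.

End AssociatedSequence.

(** * Comparison of weights through their associated sequences *)

Section Comparison.
Variable R : realType.
Implicit Types (u w : weight R) (M N : nat -> R).

(** The exponent [j.+1] instead of [j] puts the multiplicative constant and the
    ratio of a geometric bound into the single number [A]. *)
Definition geom_dominated M N : Prop :=
  exists2 A : R, 1 <= A & forall j, N j <= A ^+ j.+1 * M j.

(** For [0 < j] one has [A ^+ j.+1 <= (A ^+ 2) ^+ j], so [A ^+ 2] bounds the
    roots; the index [0], invisible to the roots, is covered by the hypothesis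
    on the first terms. *)
Lemma geom_dominated_rootP M N : (forall j, 0 < M j) -> (forall j, 0 < N j) ->
  N 0%N <= M 0%N ->
  geom_dominated M N <->
  has_ubound [set (N j / M j) `^ (j%:R^-1) | j in [set j : nat | (0 < j)%N]].
Proof.
move=> M0 N0 NM0; split=> [[A A1 NAM]|[K MK]].
- have A0 : 0 <= A by rewrite (le_trans ler01).
  exists (A ^+ 2) => _ [j /= j0 <-].
  have jn0 : (j%:R : R) != 0 by rewrite pnatr_eq0 -lt0n.
  have -> : A ^+ 2 = ((A ^+ 2) `^ j%:R) `^ (j%:R^-1).
    by rewrite -powRrM mulfV// powRr1 ?exprn_ge0.
  rewrite ge0_ler_powR ?invr_ge0 ?nnegrE ?powR_ge0//.
    by rewrite divr_ge0// ltW.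
  rewrite powR_mulrn ?exprn_ge0// -exprM ler_pdivrMr//.
  rewrite (le_trans (NAM j))// ler_wpM2r ?(ltW (M0 j))//.
  by rewrite ler_weXn2l// mul2n -addnn -[j.+1]addn1 leq_add2l.
- exists (Num.max 1 K) => [|j]; first by rewrite le_max lexx.
  have A1 : 1 <= Num.max 1 K by rewrite le_max lexx.
  have A0 : 0 <= Num.max 1 K by rewrite (le_trans ler01).
  case: j => [|j].
    by rewrite expr1 (le_trans NM0)// ler_peMl// ltW.
  rewrite -ler_pdivrMr//.
  have jn0 : (j.+1%:R : R) != 0 by rewrite pnatr_eq0.
  have -> : N j.+1 / M j.+1 = ((N j.+1 / M j.+1) `^ (j.+1%:R^-1)) ^+ j.+1.
    by rewrite -powR_mulrn ?powR_ge0// -powRrM mulVf// powRr1// divr_ge0 ?ltW.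
  apply: (@le_trans _ _ (Num.max 1 K ^+ j.+1)); last by rewrite ler_weXn2l.
  rewrite lerXn2r ?nnegrE ?powR_ge0//.
  by rewrite le_max (MK _ (ex_intro2 _ _ j.+1 _ _)) ?orbT.
Qed.

Lemma geom_dominated_weight_seq u w :
  geom_dominated (assoc_seq u) (assoc_seq w) ->
  preceq_c (weight_seq (assoc_seq u)) (weight_seq (assoc_seq w)).
Proof.
move=> [A A1 wu]; have A0 : 0 < A by rewrite (lt_le_trans ltr01).
exists A, A; split=> // t; rewrite le_eqVlt => /predU1P[<-|t0].
  by rewrite mulr0 !weight_seq0 mulr1.
rewrite -ler_pdivrMl//; apply: weight_seq_assoc_ge => // [|j].
  by rewrite mulr_gt0 ?invr_gt0 ?weight_seq_gt0.
have At0 : 0 < A * t by rewrite mulr_gt0.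
have := le_trans (weight_seq_assoc_le w j At0) (wu j).
rewrite -ler_pdivrMl ?exprn_gt0//; apply: le_trans.
rewrite exprMn exprS invfM le_eqVlt; apply/orP; left; apply/eqP.
by field; rewrite ?expf_neq0 ?gt_eqF.
Qed.

(** The hypothesis yields [w (c * t) <= C * (t * u t)] for [1 < t]. If [u] has
    moderate growth, evaluate at [H * t] and use
    [u (H * t) <= expR H * u t ^+ 2] together with the boundedness of [t * u t].
    If [w] has moderate growth, [w (H * (c * t))] is bounded by a multiple of
    [w (c * t) ^+ 2]: estimate one factor by the hypothesis, the other by [w t],
    and use the boundedness of [t * w t]. *)
Lemma preceq_c_of_weight_seq u w : normalized u -> normalized w ->
  convex_weight u -> moderate_growth u \/ moderate_growth w ->
  preceq_c (weight_seq (assoc_seq u)) (weight_seq (assoc_seq w)) ->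
  preceq_c u w.
Proof.
move=> nu nw cu mg [c [C [c1 C1 wu]]].
have c0 : 0 < c by rewrite (lt_le_trans ltr01).
have C0 : 0 < C by rewrite (lt_le_trans ltr01).
have w0 : w 0 = 1 by apply: nw; rewrite lexx ler01.
have wle1 t : 0 <= t -> w t <= 1 by move=> t0; rewrite -w0 weight_le.
have wtu t : 1 < t -> w (c * t) <= C * (t * u t).
  move=> t1; have t0 : 0 < t by rewrite (lt_trans ltr01).
  have := weight_le_weight_seq w (mulr_gt0 c0 t0).
  move=> /le_trans; apply; rewrite (le_trans (wu _ (ltW t0)))// ler_pM2l//.
  exact: convex_weight_seq_le.
pose good H D := forall t, 1 < t -> w (H * t) <= D * u t.
suff [H [D [H1 wHu]]] : exists H D : R, 1 <= H /\ good H D.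
  exists H, (Num.max 1 D); split=> // [|t t0]; first by rewrite le_max lexx.
  have ut0 := weightp_gt0 u t0; have H0 : 0 <= H by rewrite (le_trans ler01).
  have [t1|t1] := leP t 1.
    by rewrite (nu t) ?t0// mulr1 le_max (le_trans (wle1 _ _))// mulr_ge0.
  by rewrite (le_trans (wHu _ t1))// ler_pM2r// le_max lexx orbT.
case: mg => -[H H1 mgH]; have H0 : 0 < H by rewrite (lt_le_trans ltr01).
- exists (c * H), (C * H * expR H * assoc_seq u 1); split.
    by rewrite -[1]mulr1 ler_pM.
  move=> t t1; have t0 : 0 < t by rewrite (lt_trans ltr01).
  have ut0 := weightp_gt0 u (ltW t0).
  have Ht1 : 1 < H * t by rewrite (lt_le_trans t1)// ler_peMl// ltW.
  rewrite -[c * H * t]mulrA (le_trans (wtu _ Ht1))// -!mulrA.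
  rewrite ler_pM2l// ler_pM2l//.
  apply: le_trans (ler_wpM2l (ltW t0) (mgH _ (ltW t0))) _.
  have := assoc_seq_ge u 1 t0; rewrite expr1 => tu.
  rewrite mulrCA ler_pM2l ?expR_gt0// expr2 mulrA ler_pM2r//.
- exists (H * c), (C * expR H * assoc_seq w 1); split.
    by rewrite -[1]mulr1 ler_pM.
  move=> t t1; have t0 : 0 < t by rewrite (lt_trans ltr01).
  have ct0 : 0 < c * t by rewrite mulr_gt0.
  rewrite -[H * c * t]mulrA (le_trans (mgH _ (ltW ct0)))//.
  rewrite [leRHS](_ : _ = expR H * (C * assoc_seq w 1 * u t)); last by ring.
  rewrite ler_pM2l ?expR_gt0// expr2.
  have wct : w (c * t) <= w t by rewrite weight_le ?(ltW t0)// ler_peMl// ltW.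
  apply: (@le_trans _ _ (C * (t * u t) * w t)).
    by rewrite ler_pM ?wtu// ltW// weightp_gt0// ltW.
  have := assoc_seq_ge w 1 t0; rewrite expr1 => tw.
  rewrite [leLHS](_ : _ = C * (t * w t) * u t); last by ring.
  by rewrite ler_pM2r ?weightp_gt0 ?(ltW t0)// ler_pM2l.
Qed.

End Comparison.

(** * Complex power series with rapidly decreasing coefficients *)

Section PowerSeries.
Variable R : realType.
Local Notation C := (R[i]^o).
Local Notation normc := (@Normc.normc R).

Lemma normcE (z : R[i]) : `|z| = (normc z)%:C%C.
Proof. by []. Qed.

Lemma normc_real (x : R) : normc x%:C%C = `|x|.
Proof. by rewrite /Normc.normc /= expr0n /= addr0 sqrtr_sqr. Qed.

Lemma normcX (z : R[i]) n : normc (z ^+ n) = normc z ^+ n.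
Proof.
elim: n => [|n IHn]; first by rewrite !expr0 Normc.normc1.
by rewrite !exprS Normc.normcM IHn.
Qed.

Lemma ler_norm_Re (z : R[i]) : `|complex.Re z| <= normc z.
Proof. by rewrite -lecR; exact: normc_ge_Re. Qed.

Lemma ler_norm_Im (z : R[i]) : `|complex.Im z| <= normc z.
Proof.
case: z => x y /=; rewrite -[`|y|]sqrtr_sqr ler_sqrt ?lerDr ?sqr_ge0//.
by rewrite addr_ge0// sqr_ge0.
Qed.

Lemma normc_le_ReIm (z : R[i]) : normc z <= `|complex.Re z| + `|complex.Im z|.
Proof.
case: z => x y /=; rewrite -[leRHS]ger0_norm ?addr_ge0// -sqrtr_sqr.
rewrite ler_sqrt ?sqr_ge0// -[x ^+ 2]real_normK ?num_real//.
rewrite -[y ^+ 2]real_normK ?num_real// sqrrD.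
by rewrite lerD2r lerDl mulrn_wge0// mulr_ge0.
Qed.

Lemma geometric_half_sum_le (B : R) n : 0 <= B ->
  \sum_(0 <= k < n) B / 2 ^+ k <= 2 * B.
Proof.
move=> B0; suff -> : \sum_(0 <= k < n) B / 2 ^+ k = 2 * B - 2 * B / 2 ^+ n.
  by rewrite gerBl divr_ge0 ?mulr_ge0// exprn_ge0.
elim: n => [|n IHn]; first by rewrite big_geq// expr0 divr1 subrr.
by rewrite big_nat_recr//= IHn exprS; field; rewrite expf_neq0.
Qed.

Lemma cvg_series_geometric_half (x : nat -> R) (B : R) :
  (forall k, `|x k| <= B / 2 ^+ k) -> cvgn (series x).
Proof.
move=> xB; apply: normed_cvg; apply: (@series_le_cvg _ _ (geometric B 2^-1)).
- by move=> n; exact: normr_ge0.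
- by move=> n; rewrite /geometric /= exprVn (le_trans _ (xB n)).
- by move=> n; rewrite /geometric /= exprVn.
- apply: is_cvg_geometric_series.
  by rewrite ger0_norm ?invr_ge0// invf_lt1// ltr1n.
Qed.

Lemma cvg_complex (s : nat -> C) (x y : R) :
  complex.Re (s n) @[n --> \oo] --> x -> complex.Im (s n) @[n --> \oo] --> y ->
  s n @[n --> \oo] --> ((x +i* y)%C : C).
Proof.
move=> /cvgrPdist_lt sx /cvgrPdist_lt sy; apply/cvgrPdist_lt => e e0.
have /complex_realP[r er] := gtr0_real e0; rewrite er in e0 *.
have r0 : 0 < r / 2 by rewrite divr_gt0// -ltcR.
near=> n; rewrite normcE ltcR (le_lt_trans (normc_le_ReIm _))// [ltRHS]splitr.
by rewrite !raddfB/= ltrD//; near: n; [exact: sx|exact: sy].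
Unshelve. all: by end_near. Qed.

Lemma Re_series (c : nat -> C) n :
  complex.Re (series c n) = series (fun k => complex.Re (c k)) n.
Proof. by rewrite /series /= raddf_sum. Qed.

Lemma Im_series (c : nat -> C) n :
  complex.Im (series c n) = series (fun k => complex.Im (c k)) n.
Proof. by rewrite /series /= raddf_sum. Qed.

(** Convergence is reduced to that of the real and imaginary parts, which live
    in the complete space [R]. *)
Lemma cvg_complex_series (c : nat -> C) (B : R) :
  (forall k, normc (c k) <= B / 2 ^+ k) ->
  series c @ \oo -->
    ((limn (series (fun k => complex.Re (c k))) +i*
      limn (series (fun k => complex.Im (c k))))%C : C).
Proof.
move=> cB; apply: cvg_complex.
- under eq_cvg do rewrite Re_series.
  apply: (@cvg_series_geometric_half _ B) => k.
  exact: le_trans (ler_norm_Re _) (cB k).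
- under eq_cvg do rewrite Im_series.
  apply: (@cvg_series_geometric_half _ B) => k.
  exact: le_trans (ler_norm_Im _) (cB k).
Qed.

Lemma is_cvg_complex_series (c : nat -> C) (B : R) :
  (forall k, normc (c k) <= B / 2 ^+ k) -> cvgn (series c).
Proof. by move=> /cvg_complex_series/cvgP. Qed.

Lemma normc_lim_le (s : nat -> C) (l : C) (B : R) :
  s @ \oo --> l -> (forall n, normc (s n) <= B) -> normc l <= B.
Proof.
move=> /cvgrPdist_lt sl sB; apply/ler_addgt0Pl => e e0.
have e0' : 0 < e%:C%C by rewrite ltcR.
have [N _ /(_ N (leqnn N))/= Nl] := sl _ e0'.
rewrite -[l](subrK (s N)) (le_trans (le_normcD _ _))// lerD//.
by move: Nl; rewrite normcE ltcR => /ltW.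
Qed.

Lemma normc_series_le (c : nat -> C) (l : C) (B : R) :
  (forall k, normc (c k) <= B / 2 ^+ k) -> series c @ \oo --> l ->
  normc l <= 2 * B.
Proof.
move=> cB cl; apply: (normc_lim_le cl) => n.
have B0 : 0 <= B.
  by have := cB 0%N; rewrite expr0 divr1; apply: le_trans; exact: normc_ge0.
apply: le_trans (geometric_half_sum_le n B0); rewrite /series /=.
elim: n => [|n IHn]; first by rewrite !big_geq// Normc.normc0.
by rewrite !big_nat_recr//= (le_trans (le_normcD _ _))// lerD.
Qed.

(** If [D n] is the quantity estimated, then
    [D n.+1 = (z + h) * D n + h ^+ 2 * (n%:R * z ^+ n.-1)], and the bound
    follows by induction, the factor 4 leaving room for the second term. *)
Lemma exprD_taylor1_le (K : numDomainType) (z h r : K) n :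
  `|z| + 1 <= r -> `|h| <= 1 ->
  `|(z + h) ^+ n - z ^+ n - h * (n%:R * z ^+ n.-1)| <= `|h| ^+ 2 * (4 * r) ^+ n.
Proof.
move=> zr h1; have r1 : 1 <= r by apply: le_trans zr; rewrite lerDr.
have r0 : 0 <= r := le_trans ler01 r1.
have zr' : `|z| <= r by apply: le_trans zr; rewrite lerDl.
have zhr : `|z + h| <= r.
  by rewrite (le_trans (ler_normD _ _))// (le_trans _ zr)// lerD2l.
elim: n => [|n IHn].
  by rewrite !expr0 subrr mul0r mulr0 subr0 normr0 mulr1 exprn_ge0.
have -> : (z + h) ^+ n.+1 - z ^+ n.+1 - h * (n.+1%:R * z ^+ n.+1.-1) =
    (z + h) * ((z + h) ^+ n - z ^+ n - h * (n%:R * z ^+ n.-1)) +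
    h ^+ 2 * (n%:R * z ^+ n.-1).
  case: n {IHn} => [|n] /=; first by rewrite !expr0 !expr1; ring.
  rewrite expr2 !exprS -[n.+2]addn1 -[n.+1]addn1 !natrD.
  by move: ((z + h) ^+ n) (z ^+ n) => Y Z; ring.
rewrite (le_trans (ler_normD _ _))// !normrM normr_nat !normrX.
have zn : `|z| ^+ n.-1 <= r ^+ n.
  case: n {IHn} => [|n] /=; first by rewrite !expr0.
  rewrite exprS -[leLHS]mul1r ler_pM// ?exprn_ge0//.
  by rewrite lerXn2r ?nnegrE.
have nn : n%:R <= 4 ^+ n :> K.
  by rewrite -natrX ler_nat ltnW// ltn_expl.
apply: (@le_trans _ _
  (r * (`|h| ^+ 2 * (4 * r) ^+ n) + `|h| ^+ 2 * (4 * r) ^+ n)).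
  rewrite lerD//; first by rewrite ler_pM.
  rewrite ler_wpM2l ?exprn_ge0// exprMn ler_pM ?ler0n ?exprn_ge0//.
have -> : (4 * r) ^+ n.+1 = r * (4 * r) ^+ n + 3 * (r * (4 * r) ^+ n).
  by rewrite exprS; move: ((4 * r) ^+ n) => Y; ring.
rewrite mulrDr lerD//; first by rewrite mulrCA.
rewrite ler_wpM2l ?exprn_ge0// mulrA ler_peMl ?exprn_ge0 ?mulr_ge0//.
by rewrite (le_trans r1)// ler_peMl// ler1n.
Qed.

(** The derivative is the termwise one: by [exprD_taylor1_le], replacing the
    difference quotient by the series of derivatives costs at most [`|h|] times
    the sum of [`|a k| * (4 * r) ^+ k] with [r = `|z| + 1], which is finite by
    hypothesis. *)
Lemma entire_power_series (a : nat -> C) :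
  (forall r : R, 0 <= r ->
    exists B, forall k, normc (a k) * r ^+ k <= B / 2 ^+ k) ->
  entire (fun z : C => limn (series (fun k => a k * z ^+ k : C)) : C).
Proof.
move=> aB z; set f := (X in derivable X).
pose r := normc z + 1.
have r1 : 1 <= r by rewrite lerDr normc_ge0.
have r0 : 0 <= r := le_trans ler01 r1.
have r40 : 0 <= 4 * r by rewrite mulr_ge0.
have [B Bk] := aB (4 * r) r40.
have fcvg (y : C) : series (fun k => a k * y ^+ k : C) @ \oo --> f y.
  have [By Byk] := aB _ (normc_ge0 y).
  apply: (@is_cvg_complex_series _ By) => k.
  by rewrite Normc.normcM normcX.
pose d k : C := k%:R * z ^+ k.-1.
have dcvg : cvgn (series (fun k => a k * d k : C)).
  apply: (@is_cvg_complex_series _ B) => k.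
  rewrite Normc.normcM (le_trans _ (Bk k))// ler_wpM2l ?normc_ge0//.
  rewrite /d Normc.normcM normcX exprMn.
  have -> : normc k%:R = k%:R.
    by rewrite -[k%:R in LHS](rmorph_nat (real_complex R)) normc_real ger0_norm.
  apply: ler_pM; rewrite ?ler0n ?exprn_ge0 ?normc_ge0//.
    by rewrite -natrX ler_nat ltnW// ltn_expl.
  have zr : normc z <= r by rewrite lerDl.
  case: k => [|k] /=; first by rewrite !expr0.
  rewrite exprS -[leLHS]mul1r ler_pM// ?exprn_ge0 ?normc_ge0//.
  by rewrite lerXn2r ?nnegrE ?normc_ge0.
pose g : C := limn (series (fun k => a k * d k : C)).
have est (h : C) : normc h <= 1 ->
    normc (f (z + h) - f z - h * g) <= normc h ^+ 2 * (2 * B).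
  move=> h1; pose c k : C := a k * ((z + h) ^+ k - z ^+ k - h * d k).
  have ccvg : series c @ \oo --> f (z + h) - f z - h * g.
    have -> : series c = series (fun k => a k * (z + h) ^+ k : C) -
        series (fun k => a k * z ^+ k : C) -
        h *: series (fun k => a k * d k : C).
      rewrite -seriesZ -!seriesN -!seriesD; congr series; apply/funext => k /=.
      by rewrite /c !fctE /= /GRing.scale /=; ring.
    by apply: cvgB; [apply: cvgB; exact: fcvg|exact: cvgZl_tmp].
  have := @normc_series_le c _ (normc h ^+ 2 * B) _ ccvg.
  rewrite mulrCA; apply => k.
  have h1' : `|h| <= 1 by rewrite normcE lecR.
  have zr : `|z| + 1 <= (r%:C)%C by rewrite /r rmorphD rmorph1.
  have := exprD_taylor1_le k zr h1'.
  have -> : `|h| ^+ 2 * (4 * (r%:C)%C) ^+ k =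
      ((normc h ^+ 2 * (4 * r) ^+ k)%:C)%C.
    by rewrite rmorphM rmorphXn rmorphXn rmorphM/= rmorph_nat.
  rewrite normcE lecR => hk.
  rewrite /c Normc.normcM -mulrA.
  apply: le_trans (ler_wpM2l (normc_ge0 _) hk) _.
  by rewrite mulrCA ler_wpM2l ?exprn_ge0 ?normc_ge0.
apply/cvg_ex; exists g; apply/cvgrPdist_le => e e0.
have /complex_realP[s es] := gtr0_real e0; rewrite es in e0 *.
have s0 : 0 < s by rewrite -ltcR.
have B0 : 0 <= B.
  have := Bk 0%N; rewrite !expr0 divr1 mulr1; apply: le_trans; exact: normc_ge0.
have B1 : 0 < 2 * B + 1 by rewrite ltr_wpDl ?mulr_ge0.
have del0 : 0 < (s / (2 * B + 1))%:C%C by rewrite ltcR divr_gt0.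
near=> h.
have hn0 : h != 0 by near: h; exact: nbhs_dnbhs_neq.
have h1 : normc h <= 1 by rewrite -lecR -normcE; near: h; exact: dnbhs0_le.
have hs : normc h <= s / (2 * B + 1).
  by rewrite -lecR -normcE; near: h; exact: dnbhs0_le.
have nh0 : 0 < normc h by rewrite -ltcR -normcE normr_gt0.
rewrite distrC normcE lecR /= [h *: 1]mulr1 [h + z]addrC.
rewrite (_ : _ - g = h^-1 * (f (z + h) - f z - h * g)); last first.
  by rewrite [RHS]mulrBr mulKf.
rewrite Normc.normcM Normc.normcV ler_pdivrMl//.
apply: (le_trans (est h h1)); rewrite expr2 -mulrA ler_pM2l//.
apply: (@le_trans _ _ (s / (2 * B + 1) * (2 * B))).
  by rewrite ler_wpM2r ?mulr_ge0.
by rewrite mulrAC ler_pdivrMr// ler_pM2l// lerDl.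
Unshelve. all: by end_near. Qed.

End PowerSeries.

(** * Topological equality and continuous inclusions *)

Section SameSpace.
Variables (T : Type) (E F : topologicalType) (i : E -> T) (j : F -> T).
Hypotheses (i_inj : injective i) (j_inj : injective j).

Lemma image_open_cts_included : cts_included i j -> cts_included j i ->
  [set i @` U | U in open] `<=` [set j @` V | V in open].
Proof.
move=> [k jk ck] [l il cl] _ [U oU <-]; exists (l @^-1` U).
  by move/continuousP: cl; exact.
apply/seteqP; split=> [_ [y Uy <-]|_ [x Ux <-]].
  by exists (l y) => //; rewrite il.
exists (k x); rewrite ?jk//= (_ : l (k x) = x)//.
by apply: i_inj; rewrite il jk.
Qed.

Lemma same_space_cts_included : same_space i j -> cts_included i j.
Proof.
move=> [rij oij].
have /choice[k jk] : forall x, exists y, j y = i x.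
  move=> x; have : range i (i x) by exists x.
  by rewrite rij => -[y _ <-]; exists y.
exists k => //; apply/continuousP => V oV.
have : [set j @` V | V in open] (j @` V) by exists V.
rewrite -oij => -[U oU iU].
suff -> : k @^-1` V = U by [].
apply/seteqP; split=> [x /= Vkx|x Ux] /=.
  have : (j @` V) (i x) by exists (k x).
  by rewrite -iU => -[x' Ux' /i_inj <-].
have : (i @` U) (i x) by exists x.
rewrite iU => -[y Vy jy]; rewrite (_ : k x = y)//.
by apply: j_inj; rewrite jk jy.
Qed.

End SameSpace.

Lemma same_spaceP (T : Type) (E F : topologicalType) (i : E -> T) (j : F -> T) :
  injective i -> injective j ->
  same_space i j <-> cts_included i j /\ cts_included j i.
Proof.
move=> i_inj j_inj; split=> [ij|[ij ji]].
  split; first exact: same_space_cts_included.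
  by case: ij => rij oij; apply: same_space_cts_included => //; split.
split; last by apply/seteqP; split; exact: image_open_cts_included.
have [k jk _] := ij; have [l il _] := ji.
apply/seteqP; split=> [_ [x _ <-]|_ [y _ <-]].
  by exists (k x); rewrite ?jk.
by exists (l y); rewrite ?il.
Qed.

(** * Sufficiency: dominated weights give continuous inclusions *)

Section InductiveLimit.
Variables (K : numFieldType) (I J : Type).
Variables (F : I -> tvsType K) (E : lmodType K)
  (phi : forall i, {linear F i -> E}).
Variables (F' : J -> tvsType K) (E' : lmodType K)
  (phi' : forall j, {linear F' j -> E'}).

(** Universal property of the inductive limit, for maps between two of them:
    the preimage of an absolutely convex absorbing neighbourhood of 0 is again
    absolutely convex and absorbing, and the hypothesis makes it a
    neighbourhood of 0 at every step. *)
Lemma lc_final_linear_continuous (k : {linear E -> E'}) :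
  (forall i, continuous (k \o phi i : F i -> lc_final phi')) ->
  continuous (k : lc_final phi -> lc_final phi').
Proof.
move=> ck; apply/continuousP => U oU.
suff : @final_open _ _ _ _ phi (k @^-1` U) by [].
move=> x /= Ukx; have [V bV VU] : @final_core _ _ _ _ phi' U (k x).
  by apply/final_nbhsE; exact: open_nbhs_nbhs.
exists (k @^-1` V); last first.
  by move=> y Vy /=; rewrite linearD; exact: VU.
have [V1 V2 V3] := bV; split.
- by move=> a b y z ab Vy Vz /=; rewrite linearD !linearZ; exact: V1.
- move=> y; have [r r0 Vr] := V2 (k y); exists r => // a /Vr /=.
  by rewrite linearZ.
- move=> i; apply: (ck i 0); rewrite /= !linear0.
  by apply/final_nbhsE; exists V => // y; rewrite add0r.
Qed.

End InductiveLimit.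

Section Inclusions.
Variable R : realType.
Local Notation C := (R[i]^o).
Local Notation normc := (@Normc.normc R).
Implicit Types (u v w : weight R) (f : C -> C).

Lemma Hinf_set_dominated v v' (D : R) :
  0 <= D -> (forall t, 0 <= t -> v' t <= D * v t) ->
  {subset Hinf_set v <= Hinf_set v'}.
Proof.
move=> D0 vv' f /asboolP[ef [b fb]]; apply/asboolP; split=> //.
exists (D * b) => _ [z _ <-].
apply: le_trans (ler_wpM2l (normc_ge0 _) (vv' _ (normc_ge0 _))) _.
by rewrite mulrCA ler_wpM2l// weighted_le.
Qed.

Definition Hinf_incl v v' (sub : {subset Hinf_set v <= Hinf_set v'})
  (f : Hinf v) : Hinf v' := exist _ (val f) (sub _ (valP f)).

Lemma Hinf_incl_linear v v' (sub : {subset Hinf_set v <= Hinf_set v'}) :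
  linear (Hinf_incl sub).
Proof. by move=> a f g; exact: val_inj. Qed.

HB.instance Definition _ v v' (sub : {subset Hinf_set v <= Hinf_set v'}) :=
  GRing.isLinear.Build R[i] _ _ _ (Hinf_incl sub) (Hinf_incl_linear sub).

Lemma Hinf_incl_continuous v v' (sub : {subset Hinf_set v <= Hinf_set v'})
    (D : R) :
  0 <= D -> (forall t, 0 <= t -> v' t <= D * v t) ->
  continuous (Hinf_incl sub).
Proof.
move=> D0 vv'; apply: bounded_linear_continuous; apply/linear_boundedP.
exists (D%:C)%C; split; first by apply/complex_realP; exists D.
move=> r Dr f; apply: le_trans (ler_wpM2r (normr_ge0 _) (ltW Dr)).
rewrite [X in X <= _ * _](_ : _ = (sup (weighted v' (val f)))%:C%C)//.
rewrite [X in _ <= _ * X](_ : _ = (sup (weighted v (val f)))%:C%C)//.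
rewrite -rmorphM lecR; apply: ge_sup.
  by have [] := weighted_has_sup (Hinf_incl sub f).
move=> _ [z _ <-].
apply: le_trans (ler_wpM2l (normc_ge0 _) (vv' _ (normc_ge0 _))) _.
by rewrite mulrCA ler_wpM2l// weighted_le_sup.
Qed.

Lemma preceq_c_nat u w : preceq_c u w ->
  exists (c : nat) (D : R), 0 <= D /\
    forall t, 0 <= t -> w (c.+1%:R * t) <= D * u t.
Proof.
move=> [c [D [c1 D1 wu]]]; exists (Num.truncn c), D.
have c0 : 0 <= c by rewrite (le_trans ler01).
split=> [|t t0]; first by rewrite (le_trans ler01).
apply: le_trans (wu _ t0); apply: weight_le; first by rewrite mulr_ge0.
by rewrite ler_wpM2r// ltW//; have /andP[] := truncn_itv c0.
Qed.

(** The dilation constant of [preceq_c], rounded up to the integer [c.+1],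
    multiplies the index of the system: the step [n.+1] is sent to
    [c.+1 * n.+1]. *)
Lemma preceq_c_lower u w : preceq_c u w -> forall n, exists m,
  exists2 D : R, 0 <= D &
    forall t, 0 <= t -> sys_lower w m t <= D * sys_lower u n t.
Proof.
move=> /preceq_c_nat[c [D [D0 wu]]] n.
have [m mE] : exists m, m.+1 = (c.+1 * n.+1)%N by exists (n + c * n.+1)%N.
exists m, D => // t t0.
by rewrite /= mE natrM -mulrA wu// mulr_ge0.
Qed.

Lemma preceq_c_upper u w : preceq_c u w -> forall n, exists m,
  exists2 D : R, 0 <= D &
    forall t, 0 <= t -> sys_upper w n t <= D * sys_upper u m t.
Proof.
move=> /preceq_c_nat[c [D [D0 wu]]] n.
have [m mE] : exists m, m.+1 = (c.+1 * n.+1)%N by exists (n + c * n.+1)%N.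
exists m, D => // t t0.
rewrite /= mE.
have -> : n.+1%:R^-1 * t = c.+1%:R * ((c.+1 * n.+1)%N%:R^-1 * t).
  by rewrite natrM invfM !mulrA mulfV ?mul1r// pnatr_eq0.
by rewrite wu// mulr_ge0// invr_ge0.
Qed.

Definition Hlower_incl u w (sub : {subset Hlower_set u <= Hlower_set w})
  (f : Hlower_space u) : Hlower_space w := exist _ (val f) (sub _ (valP f)).

Lemma Hlower_incl_linear u w (sub : {subset Hlower_set u <= Hlower_set w}) :
  linear (Hlower_incl sub).
Proof. by move=> a f g; exact: val_inj. Qed.

HB.instance Definition _ u w (sub : {subset Hlower_set u <= Hlower_set w}) :=
  GRing.isLinear.Build R[i] _ _ _ (Hlower_incl sub) (Hlower_incl_linear sub).

Lemma preceq_c_Hlower u w : preceq_c u w ->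
  cts_included (@Hlower_fun R u) (@Hlower_fun R w).
Proof.
move=> /preceq_c_lower uw.
have sub : {subset Hlower_set u <= Hlower_set w}.
  move=> f /asboolP[n fn]; have [m [D D0 wu]] := uw n.
  by apply/asboolP; exists m; exact: (Hinf_set_dominated D0 wu fn).
exists (Hlower_incl sub) => //.
apply: lc_final_linear_continuous => n; have [m [D D0 wu]] := uw n.
pose h := Hinf_incl (Hinf_set_dominated D0 wu).
have hc : continuous h.
  exact: (@Hinf_incl_continuous _ _ (Hinf_set_dominated D0 wu) D D0 wu).
have -> : Hlower_incl sub \o @Hinf_lower R u n = @Hinf_lower R w m \o h.
  by apply/funext => f; apply: (@val_inj _ _ (Hlower_space w)).
move=> f; apply: (@continuous_comp _ _ _ h); first exact: hc.
exact: (@lc_final_continuous _ _ _ _ (fun n => @Hinf_lower R w n)).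
Qed.

(** Convergence in the projective limit is convergence at every step. *)
Lemma cvg_Hupper u (T : Type) (G : set_system T) (g : T -> Hupper u)
    (l : Hupper u) :
  Filter G -> (forall m, Hinf_upper (g x) m @[x --> G] --> Hinf_upper l m) ->
  g @ G --> l.
Proof.
move=> FG gl U [_ [[W oW <-] Wl]] /= WU.
apply: filterS WU _.
have : @Hinf_upper R u \o g @ G --> (@Hinf_upper R u l : prod_topology _).
  apply/cvg_sup => m A [_ [[B oB <-] Bl]] /= BA.
  apply: filterS BA _; apply: (gl m).
  exact: open_nbhs_nbhs.
by apply; exact: open_nbhs_nbhs.
Qed.

Lemma Hinf_upper_continuous u m :
  continuous (fun f : Hupper u => Hinf_upper f m).
Proof.
pose P : topologicalType := prod_topology (fun n => Hinf (sys_upper u n)).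
have iota_cont : continuous (@Hinf_upper R u : Hupper u -> P).
  exact: initial_continuous.
have proj_cont : continuous (fun g : P => (g m : Hinf (sys_upper u m))).
  exact: (@proj_continuous _ (fun n => Hinf (sys_upper u n)) m).
move=> f; exact: continuous_comp (iota_cont f) (proj_cont _).
Qed.

Lemma preceq_c_Hupper u w : preceq_c u w ->
  cts_included (@Hupper_fun R u) (@Hupper_fun R w).
Proof.
move=> /preceq_c_upper uw.
have sub : {subset Hupper_set u <= Hupper_set w}.
  move=> f /asboolP fn; apply/asboolP => n; have [m [D D0 wu]] := uw n.
  exact: (Hinf_set_dominated D0 wu (fn m)).
pose k (f : Hupper_space u) : Hupper_space w :=
  exist _ (val f) (sub _ (valP f)).
exists (k : Hupper u -> Hupper w) => //.
move=> f; apply: (@cvg_Hupper w _ _ _ _ (nbhs_filter f)) => n.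
have [m [D D0 wu]] := uw n.
pose h := Hinf_incl (Hinf_set_dominated D0 wu).
rewrite [X in X @ _ --> _](_ : _ =
  fun g : Hupper u => h (Hinf_upper g m)); last first.
  by apply/funext => g; exact: val_inj.
rewrite [X in _ --> X](_ : _ = h (Hinf_upper f m)); last exact: val_inj.
have hc : continuous h.
  exact: (@Hinf_incl_continuous _ _ (Hinf_set_dominated D0 wu) D D0 wu).
exact: continuous_comp (@Hinf_upper_continuous u m f) (hc _).
Qed.

End Inclusions.

(** * Necessity: inclusions bound the associated sequences *)

Section Necessity.
Variable R : realType.
Local Notation C := (R[i]^o).
Local Notation normc := (@Normc.normc R).
Implicit Types (u v w : weight R) (f : C -> C).

Lemma geom_dominated_of_bound (M N : nat -> R) (b B : R) :
  (forall j, 0 < M j) -> 1 <= B -> (forall j, N j <= b * B ^+ j * M j) ->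
  geom_dominated M N.
Proof.
move=> M0 B1 NM; pose A := Num.max 1 b.
have A1 : 1 <= A by rewrite le_max lexx.
have A0 : 0 <= A by rewrite (le_trans ler01).
have B0 : 0 <= B by rewrite (le_trans ler01).
exists (A * B) => [|j]; first by rewrite (le_trans A1)// ler_peMr.
rewrite (le_trans (NM j))// ler_pM2r// exprMn.
apply: (@le_trans _ _ (A * B ^+ j)).
  by rewrite ler_wpM2r ?exprn_ge0// le_max lexx orbT.
by rewrite ler_pM ?exprn_ge0 ?ler_eXnr// ler_weXn2l.
Qed.

(** All terms are nonnegative on the positive axis, so each one is at most the
    sum, which equals its own real part. *)
Lemma power_series_ge (a : nat -> R) (t B : R) j : (forall k, 0 <= a k) ->
  0 <= t -> (forall k, a k * t ^+ k <= B / 2 ^+ k) ->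
  a j * t ^+ j <=
    normc (limn (series (fun k => (a k)%:C%C * t%:C%C ^+ k : C)) : C).
Proof.
move=> a0 t0 aB; have at0 k : 0 <= a k * t ^+ k by rewrite mulr_ge0 ?exprn_ge0.
pose c k : C := (a k)%:C%C * t%:C%C ^+ k.
have cE k : c k = (a k * t ^+ k)%:C%C by rewrite /c rmorphM rmorphXn.
have cB k : normc (c k) <= B / 2 ^+ k by rewrite cE normc_real ger0_norm.
have -> := cvg_lim (@norm_hausdorff _ C) (cvg_complex_series cB).
apply: le_trans (ler_norm_Re _); rewrite /=.
rewrite (_ : (fun k => _) = fun k => a k * t ^+ k); last first.
  by apply/funext => k; rewrite cE.
have cv : cvgn (series (fun k => a k * t ^+ k)).
  by apply: (@cvg_series_geometric_half _ _ B) => k; rewrite ger0_norm.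
apply: le_trans (ler_norm _).
have nd : nondecreasing_seq (series (fun k => a k * t ^+ k)).
  exact: nondecreasing_series.
apply: le_trans (nondecreasing_cvgn_le nd cv j.+1).
by rewrite seriesSr lerDr sumr_ge0.
Qed.

(** Up to constants and a dilation by 2, this is the largest growth that
    membership in the space of [u] permits on the positive axis: it lies between
    [1 / weight_seq (assoc_seq u) (t / 2)] and [2 / weight_seq (assoc_seq u) t]
    at [t > 0]. *)
Definition optimal_function u : C -> C := fun z =>
  limn (series (fun k => ((2 ^+ k * assoc_seq u k)^-1)%:C%C * z ^+ k : C)).

Lemma optimal_coef_le u (r : R) k : normalized u -> 0 <= r ->
  (2 ^+ k * assoc_seq u k)^-1 * r ^+ k <= (u r)^-1 / 2 ^+ k.
Proof.
move=> nu r0; have ur0 := weightp_gt0 u r0; have M0 := assoc_seq_gt0 u k.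
rewrite invfM mulrAC -mulrA mulrC ler_wpM2r ?invr_ge0 ?exprn_ge0//.
by rewrite ler_pdivrMr// mulrC ler_pdivlMr// assoc_seq_ge0.
Qed.

Lemma optimal_function_coef_le u k (z : C) : normalized u ->
  normc (((2 ^+ k * assoc_seq u k)^-1)%:C%C * z ^+ k) <=
    (u (normc z))^-1 / 2 ^+ k.
Proof.
move=> nu; rewrite Normc.normcM normcX normc_real ger0_norm.
  exact: optimal_coef_le (normc_ge0 z).
by rewrite invr_ge0 mulr_ge0 ?exprn_ge0// ltW// assoc_seq_gt0.
Qed.

Lemma optimal_function_Hinf u : normalized u ->
  optimal_function u \in Hinf_set u.
Proof.
move=> nu; apply/asboolP; split.
  apply: entire_power_series => r r0; exists (u r)^-1 => k.
  rewrite normc_real ger0_norm; first exact: optimal_coef_le.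
  by rewrite invr_ge0 mulr_ge0 ?exprn_ge0// ltW// assoc_seq_gt0.
exists 2 => _ [z _ <-]; rewrite -ler_pdivlMr ?weight_normc_gt0//.
have zB k := optimal_function_coef_le k z nu.
exact: normc_series_le zB (is_cvg_complex_series zB).
Qed.

Lemma optimal_function_ge u (t : R) j : normalized u -> 0 <= t ->
  (2 ^+ j * assoc_seq u j)^-1 * t ^+ j <= normc (optimal_function u t%:C%C).
Proof.
move=> nu t0; apply: (@power_series_ge _ _ (u t)^-1) => // k.
  by rewrite invr_ge0 mulr_ge0 ?exprn_ge0// ltW// assoc_seq_gt0.
exact: optimal_coef_le.
Qed.

(** [optimal_function u] belongs to the inductive limit for [u], hence to some
    step of that for [w]; there the bound on its [j]-th term at [t / n.+1] is a
    bound on [t ^+ j * w t]. *)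
Lemma Hlower_geom_dominated u w : normalized u ->
  cts_included (@Hlower_fun R u) (@Hlower_fun R w) ->
  geom_dominated (assoc_seq u) (assoc_seq w).
Proof.
move=> nu [k kE _].
have fu : optimal_function u \in Hlower_set u.
  apply/asboolP; exists 0%N; apply: Hinf_set_le (optimal_function_Hinf nu).
  by move=> t t0 /=; rewrite mul1r.
pose x : Hlower_space u := exist _ (optimal_function u) fu.
have /asboolP[n /asboolP[_ [b fb]]] := valP (k x : Hlower_space w).
have {}fb z : normc (optimal_function u z) * w (n.+1%:R * normc z) <= b.
  by have := weighted_le z fb; have := kE x; rewrite /Hlower_fun => ->.
have n0 : 0 < n.+1%:R :> R by rewrite ltr0n.
apply: (@geom_dominated_of_bound _ _ b (2 * n.+1%:R)).
- by move=> j; exact: assoc_seq_gt0.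
- by rewrite -natrM ler1n.
- move=> j; apply: assoc_seq_le => t t0; set s := n.+1%:R^-1 * t.
  have s0 : 0 < s by rewrite mulr_gt0// invr_gt0.
  have := fb s%:C%C; rewrite normc_real gtr0_norm// mulrA mulfV ?gt_eqF// mul1r.
  have wt0 : 0 <= w t by rewrite ltW// weightp_gt0// ltW.
  move=> /(le_trans (ler_wpM2r wt0 (optimal_function_ge j nu (ltW s0)))).
  have M0 := assoc_seq_gt0 u j.
  have D0 : 0 < 2 ^+ j * assoc_seq u j by rewrite mulr_gt0// exprn_gt0.
  rewrite -[leLHS]mulrA ler_pdivrMl// /s exprMn exprVn.
  rewrite -[leLHS]mulrA ler_pdivrMl ?exprn_gt0//.
  move=> /le_trans; apply; rewrite le_eqVlt; apply/orP; left; apply/eqP.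
  by rewrite exprMn; ring.
Qed.

Lemma monomial_Hinf v (a : R[i]) j : (fun z : C => a * z ^+ j) \in Hinf_set v.
Proof.
apply/asboolP; split.
  move=> z; apply: derivableZ; exact: exprn_derivable.
exists (normc a * Num.max (v 0) (assoc_seq v j)) => _ [z _ <-].
rewrite Normc.normcM normcX -mulrA ler_wpM2l ?normc_ge0//.
have := normc_ge0 z; rewrite le_eqVlt => /predU1P[<-|z0].
  case: j => [|j]; first by rewrite expr0 mul1r le_max lexx.
  by rewrite expr0n mul0r le_max ltW// weightp_gt0.
by rewrite le_max assoc_seq_ge ?orbT.
Qed.

(** Let [M] and [N] be the sequences of [u] and [w]. If domination fails, then
    for each [n] there is [j] with [n.+1 ^+ j.+1 * M j < N j]. The multiples
    [z ^+ j / N j] of monomials have norm [m.+1 ^+ j * M j / N j] at the [m]-th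
    step for [u], which is less than [1 / n.+1] as soon as [m <= n]: they tend to
    0 in the projective limit. Their norm in the first step for [w] is at least
    1, against continuity. *)
Lemma Hupper_geom_dominated u w : normalized u ->
  cts_included (@Hupper_fun R u) (@Hupper_fun R w) ->
  geom_dominated (assoc_seq u) (assoc_seq w).
Proof.
move=> nu [k kE kc].
have [//|nG] := pselect (geom_dominated (assoc_seq u) (assoc_seq w)).
have /choice[j jP] : forall n, exists j,
    n.+1%:R ^+ j.+1 * assoc_seq u j < assoc_seq w j.
  move=> n; apply/not_existsP => nj; apply: nG.
  exists n.+1%:R => [|j]; first by rewrite ler1n.
  by rewrite leNgt; apply/negP; exact: nj.
pose p n : C -> C := fun z => ((assoc_seq w (j n))^-1)%:C%C * z ^+ j n.
have pH n : p n \in Hupper_set u.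
  by apply/asboolP => m; exact: monomial_Hinf.
pose g n : Hupper u := exist _ (p n) (pH n).
have g0 : g @ \oo --> (0 : Hupper u).
  apply: cvg_Hupper => m; apply/cvgrPdist_le => e e0.
  have /complex_realP[r er] := gtr0_real e0; rewrite er in e0 *.
  have r0 : 0 < r by rewrite -ltcR.
  rewrite (_ : Hinf_upper 0 m = 0); last exact: val_inj.
  near=> n; rewrite sub0r normrN.
  rewrite [X in X <= _](_ : _ =
    (sup (weighted (sys_upper u m) (Hupper_fun (g n))))%:C%C)//.
  rewrite lecR; apply: (@le_trans _ _ n.+1%:R^-1); last first.
    by apply: ltW; near: n; exact: near_infty_natSinv_lt (PosNum r0).
  apply: ge_sup => [|_ [z _ <-]].
    by exists (normc (Hupper_fun (g n) 0) * sys_upper u m (normc 0)), 0.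
  rewrite [Hupper_fun _ _]/= Normc.normcM normcX normc_real.
  have w0 := assoc_seq_gt0 w (j n).
  rewrite gtr0_norm ?invr_gt0// -mulrA ler_pdivrMl//.
  set x := normc z; have x0 : 0 <= m.+1%:R^-1 * x.
    by rewrite mulr_ge0 ?normc_ge0 ?invr_ge0.
  have := assoc_seq_ge0 (j n) nu x0.
  rewrite exprMn -mulrA exprVn ler_pdivrMl ?exprn_gt0// => /le_trans; apply.
  rewrite ler_pdivlMr// mulrC mulrA; apply: le_trans (ltW (jP n)).
  rewrite ler_pM2r ?assoc_seq_gt0// exprS ler_pM2l//.
  by rewrite lerXn2r ?nnegrE// ler_nat; near: n; exists m.
have kg : Hinf_upper (k (g n)) 0 @[n --> \oo] --> Hinf_upper (k 0) 0%N.
  have kg0 : k (g n) @[n --> \oo] --> k 0 by apply: cvg_comp g0 _; exact: kc.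
  exact: (@cvg_comp _ _ _ (k \o g) (fun f : Hupper w => Hinf_upper f 0%N)
    _ _ _ kg0 (@Hinf_upper_continuous R w 0%N (k 0))).
have : (0 : R[i]) < 1 by [].
move: kg => /cvgrPdist_lt/[apply] -[N _ /(_ N (leqnn N))] /=.
rewrite (_ : Hinf_upper (k 0) 0 = 0); last first.
  by apply: val_inj; have := kE 0; rewrite /Hupper_fun /= => ->.
rewrite sub0r normrN.
rewrite [X in X < _](_ : _ =
  (sup (weighted (sys_upper w 0) (Hupper_fun (k (g N)))))%:C%C)//.
rewrite ltcR => S1; exfalso.
set S := sup _ in S1.
have w0 := assoc_seq_gt0 w (j N).
(* S is the norm of the N-th function for w itself, the step of index 0. *)
suff : assoc_seq w (j N) <= S * assoc_seq w (j N).
  by rewrite ler_pMl// leNgt S1.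
apply: assoc_seq_le => t t0; rewrite -ler_pdivrMr// mulrC.
have := weighted_le_sup (Hinf_upper (k (g N)) 0) t%:C%C.
have -> : val (Hinf_upper (k (g N)) 0%N) = Hupper_fun (g N) by rewrite -kE.
rewrite normc_real (gtr0_norm t0) [Hupper_fun _ _]/= Normc.normcM normcX.
rewrite !normc_real (gtr0_norm t0) gtr0_norm ?invr_gt0//.
have -> : sys_upper w 0 t = w t by rewrite /= invr1 mul1r.
by rewrite mulrA /S kE.
Unshelve. all: by end_near. Qed.

End Necessity.

(** * The equivalences *)

Lemma Hlower_fun_inj (R : realType) (u : weight R) :
  injective (@Hlower_fun R u).
Proof. exact: val_inj. Qed.

Lemma Hupper_fun_inj (R : realType) (u : weight R) :
  injective (@Hupper_fun R u).
Proof. exact: val_inj. Qed.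

Theorem theorem3p25 (R : realType) (u w : weight R)
    (u_norm : normalized u) (w_norm : normalized w) :
  [/\ (convex_weight u -> moderate_growth u \/ moderate_growth w ->
       [<-> preceq_c u w;
            cts_included (@Hlower_fun R u) (@Hlower_fun R w);
            cts_included (@Hupper_fun R u) (@Hupper_fun R w)]),
      (convex_weight u -> convex_weight w ->
       moderate_growth u \/ moderate_growth w ->
       [<-> preceq_c u w;
            cts_included (@Hlower_fun R u) (@Hlower_fun R w);
            cts_included (@Hupper_fun R u) (@Hupper_fun R w);
            has_ubound [set (assoc_seq w j / assoc_seq u j) `^ (j%:R^-1)
                       | j in [set j : nat | (0 < j)%N]];
            preceq_c (weight_seq (assoc_seq u)) (weight_seq (assoc_seq w))])
    & (convex_weight u -> convex_weight w ->
       moderate_growth u -> moderate_growth w ->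
       (sim_c u w <-> same_space (@Hlower_fun R u) (@Hlower_fun R w)) /\
       (sim_c u w <-> same_space (@Hupper_fun R u) (@Hupper_fun R w)))].
Proof.
have to_preceq (v v' : weight R) : normalized v -> normalized v' ->
    convex_weight v -> moderate_growth v \/ moderate_growth v' ->
    geom_dominated (assoc_seq v) (assoc_seq v') -> preceq_c v v'.
  move=> nv nv' cv mg G; apply: preceq_c_of_weight_seq => //.
  exact: geom_dominated_weight_seq.
have rootP : geom_dominated (assoc_seq u) (assoc_seq w) <->
    has_ubound [set (assoc_seq w j / assoc_seq u j) `^ (j%:R^-1)
               | j in [set j : nat | (0 < j)%N]].
  apply: geom_dominated_rootP; [exact: assoc_seq_gt0|exact: assoc_seq_gt0|].
  by rewrite !assoc_seq0.
split=> [cu mg|cu cw mg|cu cw mu mw].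
- tfae.
  + exact: preceq_c_Hlower.
  + move=> /(Hlower_geom_dominated u_norm) G.
    by apply: preceq_c_Hupper; exact: to_preceq.
  + by move=> /(Hupper_geom_dominated u_norm) /to_preceq; exact.
- tfae.
  + exact: preceq_c_Hlower.
  + move=> /(Hlower_geom_dominated u_norm) G.
    by apply: preceq_c_Hupper; exact: to_preceq.
  + by move=> /(Hupper_geom_dominated u_norm) /rootP.
  + by move=> /rootP; exact: geom_dominated_weight_seq.
  + exact: preceq_c_of_weight_seq.
- have [mgu mgw] : (moderate_growth u \/ moderate_growth w) /\
                   (moderate_growth w \/ moderate_growth u) by split; left.
  split.
  + rewrite (same_spaceP (@Hlower_fun_inj R u) (@Hlower_fun_inj R w)).
    split=> -[uw wu]; split; try exact: preceq_c_Hlower.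
      by apply: to_preceq => //; exact: Hlower_geom_dominated.
    by apply: to_preceq => //; exact: Hlower_geom_dominated.
  + rewrite (same_spaceP (@Hupper_fun_inj R u) (@Hupper_fun_inj R w)).
    split=> -[uw wu]; split; try exact: preceq_c_Hupper.
      by apply: to_preceq => //; exact: Hupper_geom_dominated.
    by apply: to_preceq => //; exact: Hupper_geom_dominated.
Qed.
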